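(* Let $\mu,\nu$ be Borel probability measures on $\mathbb{R}^\infty$ such that for every $i\in\mathbb{N}$ and $t\in\mathbb{R}$ the shifted measure $\mu_{te_i}$ is absolutely continuous with respect to $\mu$, and such that Assumption (A) (see context) holds. Let $\mu_n,\nu_n,\pi_n,\varphi_n,\psi_n$ and the weak limit $\pi$ of $\{\pi_n\}_{n\in\mathbb{N}'}$ be as in the context. Assume that the functions $$F_n(x,y,0,0)=\varphi_n(P_nx)+\psi_n(P_ny)-\langle P_nx,P_ny\rangle$$ converge to $0$ in measure with respect to $\pi$ as $n\to\infty$, $n\in\mathbb{N}'$. Then there exists a (measurable) mapping $T:\mathbb{R}^\infty\to\mathbb{R}^\infty$ such that $T(x)=y$ for $\pi$-almost all $(x,y)$.
   Context: $\mathbb{R}^\infty=\prod_{i=1}^\infty\mathbb{R}$ is the space of all real sequences, $e_i=(\delta_{ij})_j$, $P_n(x)=(x_1,\dots,x_n)$, $\langle x,y\rangle=\sum_i x_iy_i$. $\mathbb{R}^n$ is identified with $\{x: x_j=0,\ j>n\}\subset\mathbb{R}^\infty$; a function on $\mathbb{R}^n$ is extended to $\mathbb{R}^\infty$ by composing with $P_n$. For a vector $v$, $\mu_v$ is the image of $\mu$ under $x\mapsto x+v$; for $v=te_i$ write $\frac{d\mu_v}{d\mu}=e^{\beta_v}$. Assumption (A): for every basis vector $e=e_i$ there exist $p\ge1$, $q\ge1$ with $\frac1p+\frac1q=1$ and $\varepsilon>0$ such that $\int|\langle x,e\rangle|^{(1+\varepsilon)p}\,d\nu<\infty$ and $\lim_{t\to0}\sup_{0\le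 s\le t}\int|e^{\beta_{se}}-1|^q\,d\mu=0$. $\mu_n=\mu\circ P_n^{-1}$, $\nu_n=\nu\circ P_n^{-1}$ are the projections on $\mathbb{R}^n$. $\pi_n$ is the optimal transportation plan for $(\mu_n,\nu_n)$ and the quadratic cost $|x-y|^2$ on $\mathbb{R}^n$, and $(\varphi_n,\psi_n)$ is a solution of the dual Kantorovich problem: $\varphi_n\in L^1(\mu_n),\psi_n\in L^1(\nu_n)$ are convex, $\varphi_n(x)+\psi_n(y)\ge\langle x,y\rangle$ for all $x,y\in\mathbb{R}^n$ with equality $\pi_n$-a.e., and $\nabla\varphi_n$ (resp. $\nabla\psi_n$) is the optimal transportation mapping of $\mu_n$ to $\nu_n$ (resp. $\nu_n$ to $\mu_n$). (Existence of these objects is part of the setting.) The sequence $\{\pi_n\}$, viewed on $\mathbb{R}^\infty\times\mathbb{R}^\infty$, is tight; $\mathbb{N}'\subset\mathbb{N}$ is an infinite set along which $\pi_n\to\pi$ weakly. *)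

(* Defs.v *)
From HB Require Import structures.
From mathcomp Require Import all_boot all_order all_algebra.
From mathcomp Require Import all_classical all_reals all_analysis.

Set Implicit Arguments.
Unset Strict Implicit.
Unset Printing Implicit Defensive.

Import Order.TTheory GRing.Theory Num.Theory.
Import numFieldNormedType.Exports.

Local Open Scope classical_set_scope.
Local Open Scope ring_scope.

(* R^oo with the product topology and its Borel sigma-algebra; the coordinates
   are numbered from 0. The product sigma-algebra that the library puts on
   Rinf R * Rinf R is the Borel one, because Rinf R is second countable. *)
Definition Rinf (R : realType) : Type := nat -> R.

HB.instance Definition _ (R : realType) := Pointed.copy (Rinf R) (nat -> R).
HB.instance Definition _ (R : realType) :=
  Topological.copy (Rinf R) (prod_topology (fun _ : nat => R)).
HB.instance Definition _ (R : realType) :=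
  @isMeasurable.Build (sigma_display (@open (Rinf R))) (Rinf R)
    <<s @open (Rinf R) >> (@sigma_algebra0 _ setT _)
    (@sigma_algebraC (Rinf R) _) (@sigma_algebra_bigcup _ setT _).

Definition Rn (R : realType) (n : nat) : Type := 'rV[R]_n.

HB.instance Definition _ (R : realType) n :=
  PointedTopological.copy (Rn R n) 'rV[R]_n.
HB.instance Definition _ (R : realType) n :=
  @isMeasurable.Build (sigma_display (@open (Rn R n))) (Rn R n)
    <<s @open (Rn R n) >> (@sigma_algebra0 _ setT _)
    (@sigma_algebraC (Rn R n) _) (@sigma_algebra_bigcup _ setT _).

Lemma continuous_borel_measurable (S T : ptopologicalType) (f : S -> T) :
  continuous f ->
  measurable_fun [set: g_sigma_algebraType (@open S)]
    (f : g_sigma_algebraType (@open S) -> g_sigma_algebraType (@open T)).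
Proof.
move=> /continuousP cf.
apply: (@measurability _ _ (g_sigma_algebraType (@open S))
  (g_sigma_algebraType (@open T)) setT f (@open T)) => // _ [B oB <-].
by rewrite setTI; apply: sub_sigma_algebra; exact: cf.
Qed.

Section maps.
Variable R : realType.

Lemma Rinf_coord_continuous (j : nat) : continuous (fun x : Rinf R => x j : R).
Proof. exact: (@proj_continuous nat (fun=> R) j). Qed.

Lemma continuous_Rinf (T : topologicalType) (f : T -> Rinf R) :
  (forall j, continuous (fun x => f x j : R)) -> continuous f.
Proof.
move=> cf x; apply/cvg_sup => j.
move: x; apply/(@continuousP _ (initial_topology (@^~ j))) => A [B oB <-].
by rewrite -comp_preimage; apply: open_comp => // y _; exact: cf.
Qed.

Lemma continuous_Rn (T : topologicalType) n (f : T -> Rn R n) :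
  (forall j, continuous (fun x => (f x : 'rV[R]_n) ord0 j)) -> continuous f.
Proof.
move=> cf x A [P fP sPA].
have : \forall y \near x, forall j, P ord0 j ((f y : 'rV[R]_n) ord0 j).
  by apply: filter_forall => j; exact: cf (fP ord0 j).
by apply: filterS => y Py; apply: sPA => i j; rewrite (ord1 i); exact: Py.
Qed.

(* P_n *)
Definition proj_n n (x : Rinf R) : Rn R n := \row_(j < n) (x j : R).

(* the inclusion of R^n into R^oo *)
Definition incl_n n (u : Rn R n) : Rinf R :=
  fun j => if insub j is Some i then (u : 'rV[R]_n) ord0 i else 0.

Definition incl2_n n (z : Rn R n * Rn R n) : Rinf R * Rinf R :=
  (incl_n z.1, incl_n z.2).

(* x |-> x + t e_i *)
Definition shift_e (i : nat) (t : R) (x : Rinf R) : Rinf R :=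
  fun j => (x j : R) + t * (i == j)%:R.

Lemma measurable_proj_n n : measurable_fun setT (@proj_n n).
Proof.
apply: (@continuous_borel_measurable (Rinf R) (Rn R n)).
apply: continuous_Rn => j.
under eq_fun do rewrite mxE; exact: Rinf_coord_continuous.
Qed.

Lemma measurable_incl_n n : measurable_fun setT (@incl_n n).
Proof.
apply: (@continuous_borel_measurable (Rn R n) (Rinf R)).
apply: continuous_Rinf => j; rewrite /incl_n.
case: insubP => [i _ _|_]; last exact: cst_continuous.
exact: coord_continuous.
Qed.

Lemma measurable_incl2_n n : measurable_fun setT (@incl2_n n).
Proof.
apply: measurable_fun_pair.
- exact: measurableT_comp (@measurable_incl_n n) measurable_fst.
- exact: measurableT_comp (@measurable_incl_n n) measurable_snd.
Qed.

Lemma measurable_shift_e i t : measurable_fun setT (@shift_e i t).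
Proof.
apply: (@continuous_borel_measurable (Rinf R) (Rinf R)).
apply: continuous_Rinf => j x.
apply: (@cvgD _ R^o); first exact: (nbhs_filter x).
- exact: (@Rinf_coord_continuous j x).
- exact: (@cvg_cst _ _ _ _ (nbhs_filter x)).
Qed.

HB.instance Definition _ n :=
  isMeasurableFun.Build _ _ _ _ (@proj_n n) (@measurable_proj_n n).
HB.instance Definition _ n :=
  isMeasurableFun.Build _ _ _ _ (@incl2_n n) (@measurable_incl2_n n).
HB.instance Definition _ i t :=
  isMeasurableFun.Build _ _ _ _ (@shift_e i t) (@measurable_shift_e i t).

End maps.

Section finite_dimensional.
Variables (R : realType) (n : nat).
Implicit Types (u v x y : 'rV[R]_n) (mu nu : probability (Rn R n) R)
  (pi : probability (Rn R n * Rn R n)%type R).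

Definition dotv u v : R := \sum_(j < n) u ord0 j * v ord0 j.

(* |u - v|^2 for the Euclidean norm; the norm of the library on 'rV[R]_n is the
   sup norm. *)
Definition sqdist u v : R := dotv (u - v) (u - v).

Definition coupling mu nu pi : Prop :=
  forall A : set (Rn R n), measurable A ->
    pi (A `*` setT) = mu A /\ pi (setT `*` A) = nu A.

Definition optimal_plan mu nu pi : Prop :=
  coupling mu nu pi /\
  forall pi', coupling mu nu pi' ->
    (\int[pi]_z (sqdist z.1 z.2)%:E <= \int[pi']_z (sqdist z.1 z.2)%:E)%E.

(* T transports mu to nu, and the plan (id, T)_# mu is optimal. *)
Definition optimal_map mu nu (T : Rn R n -> Rn R n) : Prop :=
  [/\ measurable_fun setT T,
      forall B : set (Rn R n), measurable B -> mu (T @^-1` B) = nu B &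
      forall pi', coupling mu nu pi' ->
        (\int[mu]_x (sqdist x (T x))%:E <= \int[pi']_z (sqdist z.1 z.2)%:E)%E].

(* Convex functions take values in ]-oo, +oo]: a potential psi_n is +oo off the
   closed convex hull of the support of nu_n when that support is bounded. The
   value -oo is excluded by the inequality in [dual_solution], because
   -oo + +oo = -oo in \bar R. *)
Definition econvex (f : 'rV[R]_n -> \bar R) : Prop :=
  forall x y (t : R), 0 <= t <= 1 ->
    (f (t *: x + (1 - t) *: y)%R <= t%:E * f x + (1 - t)%:E * f y)%E.

Definition is_gradient (f : 'rV[R]_n -> \bar R) x v : Prop :=
  (\forall z \near x, f z \is a fin_num) /\
  is_diff x (fine \o f : 'rV[R]_n -> R^o) (dotv v).

(* "the gradient of f is the optimal transportation mapping of mu to nu"; the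
   gradient need only exist mu-almost everywhere. *)
Definition optimal_gradient mu nu (f : 'rV[R]_n -> \bar R) : Prop :=
  exists2 T : Rn R n -> Rn R n, optimal_map mu nu T &
    {ae mu, forall x, is_gradient f x (T x)}.

Record dual_solution mu nu pi (phi psi : Rn R n -> \bar R) : Prop := {
  dual_integrable_phi : mu.-integrable setT phi;
  dual_integrable_psi : nu.-integrable setT psi;
  dual_convex_phi : econvex phi;
  dual_convex_psi : econvex psi;
  dual_ge : forall x y, ((dotv x y)%:E <= phi x + psi y)%E;
  dual_eq : {ae pi, forall z, (phi z.1 + psi z.2 = (dotv z.1 z.2)%:E)%E};
  dual_gradient_phi : optimal_gradient mu nu phi;
  dual_gradient_psi : optimal_gradient nu mu psi }.

End finite_dimensional.

Section infinite_dimensional.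
Variable R : realType.
Implicit Types (mu nu : probability (Rinf R) R)
  (pi : probability (Rinf R * Rinf R)%type R).
Local Open Scope ereal_scope.

(* d mu_v / d mu = e^{beta_v} for v = t e_i, where mu_v is the image of mu under
   x |-> x + v *)
Definition exp_beta mu (i : nat) (t : R) : Rinf R -> \bar R :=
  Radon_Nikodym (charge_of_finite_measure (distribution mu (@shift_e R i t))) mu.

(* The exponents are finite, so p and q are in fact > 1. The supremum over
   0 <= s <= t makes the limit one-sided. *)
Definition assumption_A mu nu : Prop :=
  forall i : nat, exists p q eps : R,
    [/\ (1 <= p)%R, (1 <= q)%R, (p^-1 + q^-1 = 1)%R & (0 < eps)%R] /\
    \int[nu]_x (`|x i : R| `^ ((1 + eps) * p))%:E < +oo /\
    ereal_sup [set \int[mu]_x (`|exp_beta mu i s x - 1| `^ q)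
              | s in `[0%R, t]%classic]
      @[t --> (0 : R)%R^'+] --> 0.

Definition tight (P : nat -> probability (Rinf R * Rinf R)%type R) : Prop :=
  forall eps : R, (0 < eps)%R ->
    exists2 K : set (Rinf R * Rinf R), compact K &
      forall n, (0 < n)%N -> P n (~` K) <= eps%:E.

Definition weak_limit (F : set_system nat)
    (P : nat -> probability (Rinf R * Rinf R)%type R) pi : Prop :=
  forall f : Rinf R * Rinf R -> R, continuous f ->
    (exists M : R, forall z, (`|f z| <= M)%R) ->
    (\int[P n]_z (f z)%:E) @[n --> F] --> \int[pi]_z (f z)%:E.

Definition cvg_in_measure (F : set_system nat) pi
    (f : nat -> Rinf R * Rinf R -> \bar R) : Prop :=
  forall delta : R, (0 < delta)%R ->
    pi [set z | delta%:E <= `|f n z|] @[n --> F] --> 0.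

(* F_n(x, y, 0, 0): the duality gap phi_n(x) + psi_n(y) - <x, y> without shifts
   of the arguments *)
Definition Fn0 (phi psi : forall n, Rn R n -> \bar R) (n : nat)
    (z : Rinf R * Rinf R) : \bar R :=
  phi n (proj_n n z.1) + psi n (proj_n n z.2)
  - (dotv (proj_n n z.1) (proj_n n z.2))%:E.

End infinite_dimensional.

(* Main.v *)
Require Import Defs.
From mathcomp Require Import all_boot all_order all_algebra.
From mathcomp Require Import all_classical all_reals all_analysis.
From mathcomp Require Import measurable_realfun lra.

(** Write gap_n (x, y) = phi_n (P_n x) + psi_n (P_n y) - <P_n x, P_n y> for the
    duality gap, T_n for the gradient of phi_n, and fix a coordinate i and t > 0.
    The subgradient inequality for the convex function phi_n at the shifted
    point P_n (x + t e_i), combined with the duality inequality at the pair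
    (P_n (x + t e_i), P_n y), gives

      t (y_i - T_n (P_n (x + t e_i))_i) <= gap_n (x, y)

    for pi-almost all (x, y) ([gap_ge]); the gradient exists at the shifted point
    almost surely because mu is quasi-invariant. As gap_n tends to 0 in measure,
    y_i exceeds W (x) = T_n (P_n (x + t e_i))_i by more than a given h only with
    small probability. So {y_i > c} is nearly contained in {W > c}.

    The two sets also have nearly the same measure, which turns the inclusion
    into an approximate equality. Indeed T_n sends mu_n to nu_n, so that without
    the shift {W > c} would have measure nu {y_i > c} exactly; and the shift
    changes measures by little when t is small, since the density e^{beta} of the
    shifted measure tends to 1 in L^1 (mu) ([shift_continuity]). Comparing the
    measures of sets {y_i > c}, rather than integrals of y_i, reduces what is
    asked of the shifts to continuity in total variation.

    Hence {y_i > c} is approximated in pi-measure by sets {x in A}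
    ([ray_approximation]); by Borel-Cantelli it agrees with one such set A_c up
    to a pi-null set ([approximable_preimage]), and y_i is then almost surely the
    supremum of the rationals c with x in A_c ([factor_through]). Doing this for
    every i gives T.

    The comparison of measures uses that pi has marginals mu and nu, which weak
    convergence transfers from the plans pi_n ([limit_marginal]). *)

Set Implicit Arguments.
Unset Strict Implicit.
Unset Printing Implicit Defensive.

Import Order.TTheory GRing.Theory Num.Theory.
Import numFieldNormedType.Exports.

Local Open Scope classical_set_scope.
Local Open Scope ring_scope.

(** * The Borel sigma-algebra of the space of sequences *)

(** Lists of constraints index cylinders with rational sides: there are countably
    many lists, and concatenating two of them intersects the cylinders. *)
Definition rat_box (R : realType) (s : seq (nat * (rat * rat))) :
    set (Rinf R) :=
  [set x | forall p, p \in s -> ratr p.2.1 < (x p.1 : R) < ratr p.2.2].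

(** The sets containing some box around [x] form a filter, which converges to [x]
    coordinate by coordinate, hence in the product topology. *)
Lemma open_rat_box (R : realType) (U : set (Rinf R)) (x : Rinf R) :
  open U -> U x -> exists2 s, rat_box s x & rat_box s `<=` U.
Proof.
move=> oU Ux.
pose F : set_system (Rinf R) :=
  [set A | exists2 s, rat_box s x & rat_box s `<=` A].
suff FU : F U by exact: FU.
have FF : Filter F.
  split.
  - by exists [::].
  - move=> A B [s sx sA] [s' sx' sB]; exists (s ++ s').
      by move=> p; rewrite mem_cat => /orP[]; [exact: sx|exact: sx'].
    move=> y sy; split.
      by apply: sA => p ps; apply: sy; rewrite mem_cat ps.
    by apply: sB => p ps; apply: sy; rewrite mem_cat ps orbT.
  - by move=> A B AB [s sx sA]; exists s => //; exact: subset_trans AB.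
suff Fx : F --> (x : Rinf R) by apply: Fx; exact: open_nbhs_nbhs.
apply/cvg_sup => j A; rewrite nbhsE/= => -[B [[C oC CB] Bx] BA].
have : nbhs (x j : R) C by apply: open_nbhs_nbhs; split => //; rewrite -CB in Bx.
move=> /nbhs_ballP[e/= e0 eC].
have [a] := @rat_in_itvoo R (x j - e) (x j) ltac:(by rewrite ltrBlDr ltrDl).
rewrite in_itv/= => /andP[a1 a2].
have [b] := @rat_in_itvoo R (x j) (x j + e) ltac:(by rewrite ltrDl).
rewrite in_itv/= => /andP[b1 b2].
exists [:: (j, (a, b))].
  by move=> p; rewrite inE => /eqP ->/=; rewrite a2 b1.
move=> y /(_ (j, (a, b)) (mem_head _ _))/= /andP[ya yb].
apply: BA; rewrite -CB; apply: eC.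
rewrite /ball/= ltr_distl; apply/andP; split; lra.
Qed.

(** The Borel and the product sigma-algebras of [Rinf R] coincide: by
    [open_rat_box] an open set is the union of the boxes that it contains, and
    there are only countably many of them. *)
Lemma measurable_Rinf (R : realType) d (S : measurableType d)
    (f : S -> Rinf R) :
  (forall j, measurable_fun setT (fun x => f x j : R)) ->
  measurable_fun setT f.
Proof.
move=> mf; apply: (@measurability _ _ S (Rinf R) setT f (@open (Rinf R))) => //.
move=> _ [U oU <-]; rewrite setTI.
have -> : f @^-1` U = \bigcup_(s in [set s | rat_box s `<=` U])
    f @^-1` (rat_box s).
  apply/seteqP; split => x /=.
    by move=> /(open_rat_box oU)[s sx sU]; exists s.
  by move=> [s sU sx]; exact: sU.
rewrite bigcup_mkcond; apply: countable_bigcupT_measurable => // s.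
case: ifP => // _; elim: s => [|[j [a b]] s ihs].
  by rewrite (_ : _ @^-1` _ = setT)//; apply/seteqP; split.
have -> : f @^-1` rat_box ((j, (a, b)) :: s) =
    (fun x => f x j : R) @^-1` `]ratr a, ratr b[%classic
    `&` f @^-1` (rat_box s).
  apply/seteqP; split => x /=.
    move=> fx; split; last by move=> p ps; apply: fx; rewrite inE ps orbT.
    by rewrite in_itv/=; apply: (fx (j, (a, b))); rewrite inE eqxx.
  move=> [+ fx] p; rewrite in_itv inE/= => fj /orP[/eqP ->//|]; exact: fx.
apply: measurableI => //; rewrite -[_ @^-1` _]setTI.
exact: mf.
Qed.

Lemma continuous_Rinf_measurable (R : realType) (f : Rinf R -> R) :
  continuous f -> measurable_fun setT f.
Proof.
move=> cf; apply: (measurability _ (RGenOpens.measurableE R)).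
move=> _ [_ [a [b ->] <-]].
by rewrite setTI; apply: sub_sigma_algebra; exact: open_comp.
Qed.

Lemma measurable_coord (R : realType) j :
  measurable_fun setT (fun x : Rinf R => x j : R).
Proof.
by apply: continuous_Rinf_measurable => x; exact: Rinf_coord_continuous.
Qed.

Lemma measurable_Rn_coord (R : realType) n (j : 'I_n) :
  measurable_fun setT (fun u : Rn R n => (u : 'rV[R]_n) ord0 j).
Proof.
apply: (measurability _ (RGenOpens.measurableE R)) => _ [_ [a [b ->] <-]].
rewrite setTI; apply: sub_sigma_algebra; apply: open_comp => //.
by move=> x _; exact: coord_continuous.
Qed.

(** * Measures determined by continuous cylinder functions *)

(** A list may constrain finitely many coordinates and leave the others free, so
    these sets form a pi-system that contains the whole space. *)
Definition orthant (R : realType) (s : seq (nat * R)) : set (Rinf R) :=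
  [set x | forall p, p \in s -> p.2 < (x p.1 : R)].

(** A continuous function of finitely many coordinates that increases with [k] to
    the indicator of [orthant s]. *)
Definition ramp (R : realType) (k : nat) (s : seq (nat * R)) (x : Rinf R) : R :=
  \prod_(p <- s) Num.min 1 (k%:R * Num.max 0 ((x p.1 : R) - p.2)).

Lemma continuous_ramp (R : realType) k s : continuous (@ramp R k s).
Proof.
have cst (a : R) (x : Rinf R) : {for x, continuous (fun _ : Rinf R => a)}.
  exact: (@cvg_cst _ _ _ _ (nbhs_filter x)).
rewrite /ramp; elim: s => [|p s ihs] x.
  by under eq_fun do rewrite big_nil; exact: cst.
under eq_fun do rewrite big_cons.
apply: (@cvgM _ _ _ (nbhs_filter x) _ _ _ _ _ (ihs x)).
apply: (@continuous_min R (Rinf R) (fun=> 1) _ x (cst 1 x)).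
apply: (@cvgM _ _ _ (nbhs_filter x) _ _ _ _ (cst _ x)).
apply: (@continuous_max R (Rinf R) (fun=> 0) _ x (cst 0 x)).
apply: (@cvgB _ R^o _ _ (nbhs_filter x) _ _ _ _ _ (cst _ x)).
exact: (@Rinf_coord_continuous R p.1 x).
Qed.

Lemma ramp_itv (R : realType) k s (x : Rinf R) : 0 <= ramp k s x <= 1.
Proof.
rewrite /ramp; elim: s => [|p s /andP[s0 s1]]; first by rewrite big_nil ler01 lexx.
rewrite big_cons.
have h0 : 0 <= Num.min 1 (k%:R * Num.max 0 ((x p.1 : R) - p.2)).
  by rewrite le_min ler01/= mulr_ge0// le_max lexx.
by rewrite mulr_ge0//= mulr_ile1// ge_min lexx.
Qed.

Lemma ramp_nondecreasing (R : realType) s (x : Rinf R) :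
  {homo (fun k => ramp k s x) : n m / (n <= m)%N >-> n <= m}.
Proof.
move=> n m nm; rewrite /ramp.
elim: s => [|p s ihs]; first by rewrite !big_nil.
have /andP[s0 _] := ramp_itv n s x.
rewrite !big_cons ler_pM//.
  by rewrite le_min ler01/= mulr_ge0// le_max lexx.
by rewrite le_min2// ler_wpM2r ?ler_nat// le_max lexx.
Qed.

Lemma ramp_cvg (R : realType) s (x : Rinf R) :
  (ramp k s x)%:E @[k --> \oo] --> (\1_(orthant s) x)%:E.
Proof.
have [xs|xs] := pselect (orthant s x); last first.
  suff r0 k : ramp k s x = 0.
    by under eq_fun do rewrite r0; rewrite indicE memNset//; exact: cvg_cst.
  move/existsNP : xs => [p /not_implyP[ps /negP]]; rewrite -leNgt => xp.
  rewrite /ramp (perm_big _ (perm_to_rem ps)) big_cons/=.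
  have -> : Num.max 0 ((x p.1 : R) - p.2) = 0 by rewrite max_l// subr_le0.
  by rewrite mulr0 min_r// mul0r.
rewrite indicE mem_set//; apply: cvg_near_cst.
suff : \forall k \near \oo, ramp k s x = 1 by apply: filterS => k ->.
elim: s xs => [|p s ihs] xs.
  by apply: nearW => k; rewrite /ramp big_nil.
have xp : 0 < (x p.1 : R) - p.2 by rewrite subr_gt0; apply: xs; rewrite mem_head.
have {}/ihs ihs : orthant s x by move=> q qs; apply: xs; rewrite inE qs orbT.
near=> k; rewrite /ramp big_cons -/(ramp k s x) (near ihs k)//.
rewrite mulr1 max_r ?ltW// min_l// -ler_pdivrMr// mul1r.
by near: k; exact: nbhs_infty_ger.
Unshelve. all: by end_near. Qed.

Lemma Rinf_measurable_orthants (R : realType) :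
  @measurable _ (Rinf R) = <<s range (@orthant R) >>.
Proof.
apply/seteqP; split => [A mA|].
  pose S := g_sigma_algebraType (range (@orthant R)).
  have mid : measurable_fun setT (id : S -> Rinf R).
    apply: measurable_Rinf => j.
    apply: (measurability _ (RGenOInfty.measurableE R)) => _ [_ [a ->] <-].
    rewrite setTI; apply: sub_sigma_algebra; exists [:: (j, a)] => //.
    apply/seteqP; split => x /=.
      by move=> /(_ (j, a) (mem_head _ _)); rewrite in_itv/= andbT.
    by rewrite in_itv/= andbT => jx p; rewrite inE => /eqP ->.
  by have := mid measurableT A mA; rewrite setTI.
apply: smallest_sub; first exact: sigma_algebra_measurable.
move=> _ [s _ <-]; elim: s => [|p s ihs].
  by rewrite (_ : orthant _ = setT)//; apply/seteqP; split.
have -> : orthant (p :: s) =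
    (fun x : Rinf R => x p.1 : R) @^-1` `]p.2, +oo[%classic `&` orthant s.
  apply/seteqP; split => x /=.
    move=> xs; split; last by move=> q qs; apply: xs; rewrite inE qs orbT.
    by rewrite in_itv/= andbT; apply: xs; rewrite mem_head.
  move=> [+ xs] q; rewrite in_itv/= andbT inE => xp /orP[/eqP ->//|]; exact: xs.
by apply: measurableI => //; rewrite -[_ @^-1` _]setTI; exact: measurable_coord.
Qed.

(** Monotone convergence along the ramps identifies the values on orthants, and the
    uniqueness theorem for pi-systems extends this to all Borel sets. *)
Lemma Rinf_measure_ext (R : realType) (P Q : probability (Rinf R) R) :
  (forall k s, \int[P]_x (ramp k s x)%:E = \int[Q]_x (ramp k s x)%:E)%E ->
  forall A, measurable A -> P A = Q A.
Proof.
move=> PQ; apply: (measure_unique (range (@orthant R)) (fun=> setT)).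
- exact: Rinf_measurable_orthants.
- move=> _ _ [s _ <-] [s' _ <-]; exists (s ++ s') => //.
  apply/seteqP; split => x /=.
    by move=> xs; split => p ps; apply: xs; rewrite mem_cat ps ?orbT.
  by move=> [xs xs'] p; rewrite mem_cat => /orP[]; [exact: xs|exact: xs'].
- by move=> _; exists [::] => //; apply/seteqP; split.
- by rewrite bigcup_const.
- move=> _ [s _ <-].
  have ms : measurable (orthant s).
    by rewrite Rinf_measurable_orthants; apply: sub_sigma_algebra; exists s.
  have cv (M : probability (Rinf R) R) :
      (\int[M]_x (ramp k s x)%:E)%E @[k --> \oo] --> M (orthant s).
    have -> : M (orthant s) = (\int[M]_x (\1_(orthant s) x)%:E)%E.
      by rewrite integral_indic// setIT.
    rewrite (_ : (fun x => (\1_(orthant s) x)%:E) =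
                 (fun x => limn (fun k => (ramp k s x)%:E))); last first.
      by apply/funext => x; apply/esym/cvg_lim => //; exact: ramp_cvg.
    apply: cvg_monotone_convergence => //.
    + move=> k; apply/measurable_EFinP; apply: continuous_Rinf_measurable.
      exact: continuous_ramp.
    + by move=> k x _; rewrite lee_fin; case/andP: (ramp_itv k s x).
    + by move=> x _ k l kl; rewrite lee_fin; exact: ramp_nondecreasing.
  have cQ := cv Q.
  rewrite -(funext (PQ ^~ s)) in cQ.
  exact: cvg_unique (cv P) cQ.
- by move=> _ /=; rewrite probability_setT ltry.
Qed.

(** * Marginals of the weak limit *)

Lemma ramp_incl_proj (R : realType) k s (x : Rinf R) n :
  (forall p, p \in s -> (p.1 < n)%N) ->
  ramp k s (incl_n (proj_n n x)) = ramp k s x.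
Proof.
move=> sn; apply: eq_big_seq => p /sn pn.
by rewrite /incl_n insubT/= mxE.
Qed.

Lemma integral_ramp_incl (R : realType) (mu : probability (Rinf R) R) n
    (P : probability (Rn R n * Rn R n)%type R) (g : Rn R n * Rn R n -> Rn R n)
    k s :
  measurable_fun setT g ->
  (forall A, measurable A -> P (g @^-1` A) = distribution mu (@proj_n R n) A) ->
  (forall p, p \in s -> (p.1 < n)%N) ->
  (\int[P]_z (ramp k s (incl_n (g z)))%:E = \int[mu]_x (ramp k s x)%:E)%E.
Proof.
move=> mg Pg sn.
pose X := mfun_Sub (mem_set mg : g \in mfun).
have mr : measurable_fun setT (fun u : Rn R n => (ramp k s (incl_n u))%:E).
  apply/measurable_EFinP; apply: measurableT_comp (@measurable_incl_n R n).
  by apply: continuous_Rinf_measurable; exact: continuous_ramp.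
have r0 u : (0 <= (ramp k s (incl_n u))%:E)%E.
  by rewrite lee_fin; case/andP: (ramp_itv k s (incl_n u)).
transitivity (\int[distribution P X]_u (ramp k s (incl_n u))%:E)%E.
  by rewrite ge0_integral_distribution.
transitivity (\int[distribution mu (@proj_n R n)]_u (ramp k s (incl_n u))%:E)%E.
  by apply: eq_measure_integral => A mA _; exact: Pg.
rewrite ge0_integral_distribution//; apply: eq_integral => x _ /=.
by rewrite ramp_incl_proj.
Qed.

Lemma within_infinite_proper (N' : set nat) :
  infinite_set N' -> ProperFilter (within N' \oo).
Proof.
move=> N'inf; apply: Build_ProperFilter_ex => A [N _ NA].
apply: contrapT => nA; apply: N'inf; apply: (@sub_finite_set _ _ `I_N).
  move=> n N'n /=; rewrite ltnNge; apply/negP => Nn.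
  by apply: nA; exists n; exact: NA Nn N'n.
exact: finite_II.
Qed.

Section marginals.
Variables (R : realType) (F : set_system nat) (FF : ProperFilter F).
Variable F_oo : F --> \oo.
Variable pi_ : forall n : nat, probability (Rn R n * Rn R n)%type R.
Variable pi : probability (Rinf R * Rinf R)%type R.
Hypothesis pi_limit :
  weak_limit F (fun n => distribution (pi_ n) (@incl2_n R n)) pi.

(** A ramp depends on finitely many coordinates only, so it has the same integral
    against the [n]-th marginal as against [mu] as soon as [n] exceeds them: the
    sequence whose limit defines the marginal of [pi] is eventually constant.
    Taking [g] to be [fst] or [snd] covers both marginals. *)
Lemma limit_marginal (mu : probability (Rinf R) R)
    (g : Rinf R * Rinf R -> Rinf R)
    (gn : forall n, Rn R n * Rn R n -> Rn R n) :
  continuous g -> measurable_fun setT g ->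
  (forall n, measurable_fun setT (@gn n)) ->
  (forall n z, g (incl2_n z) = incl_n (@gn n z)) ->
  (forall n, (0 < n)%N -> forall A, measurable A ->
    pi_ n (@gn n @^-1` A) = distribution mu (@proj_n R n) A) ->
  forall A, measurable A -> pi (g @^-1` A) = mu A.
Proof.
move=> cg mg mgn ggn pin.
pose X := mfun_Sub (mem_set mg : g \in mfun).
apply: (@Rinf_measure_ext R (distribution pi X) mu) => k s.
have mr : measurable_fun setT (fun x : Rinf R => (ramp k s x)%:E).
  apply/measurable_EFinP.
  by apply: continuous_Rinf_measurable; exact: continuous_ramp.
have r0 x : (0 <= (ramp k s x)%:E)%E.
  by rewrite lee_fin; case/andP: (ramp_itv k s x).
rewrite ge0_integral_distribution//.
have cr : continuous (ramp k s \o g).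
  by move=> z; apply: continuous_comp; [exact: cg|exact: continuous_ramp].
have br : exists M : R, forall z, `|(ramp k s \o g) z| <= M.
  exists 1 => z; have /andP[r1 r2] := ramp_itv k s (g z).
  by rewrite /= ger0_norm.
apply: (cvg_unique _ (pi_limit cr br)) => //.
apply: cvg_near_cst.
pose N := (\max_(p <- s) p.1.+1)%N.
have : \forall n \near F, (N.+1 <= n)%N by apply: F_oo; exact: nbhs_infty_ge.
apply: filterS => n Nn.
rewrite ge0_integral_distribution/=.
- under eq_integral do rewrite ggn.
  apply: integral_ramp_incl => //; first exact: (pin n (leq_ltn_trans _ Nn)).
  move=> p ps; apply: leq_trans (ltnW Nn).
  exact: (@leq_bigmax_seq _ s xpredT (fun p : nat * R => p.1.+1) p ps isT).
- exact: (measurableT_comp mr mg).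
- by move=> z; exact: r0.
Qed.

End marginals.

(** * The subgradient inequality and the duality gap *)

(** Convexity bounds the slopes (f (w + h (z - w)) - f w) / h for h in ]0, 1] by
    f z - f w, and they tend to <v, z - w> as h decreases to 0. *)
Lemma subgradient (R : realType) n (f : 'rV[R]_n -> \bar R) (w v z : 'rV[R]_n) :
  econvex f -> (forall x, f x != -oo%E) -> is_gradient f w v ->
  (f w + (dotv v (z - w))%:E <= f z)%E.
Proof.
move=> cf fNy [finw dfw].
have fw := nbhs_singleton finw.
case fz : (f z) => [a| |]; last first.
- by have := fNy z; rewrite fz.
- by rewrite leey.
rewrite -(fineK fw) -EFinD lee_fin -lerBrDl.
have diffw : differentiable (fine \o f : 'rV[R]_n -> R^o) w by [].
have dq := @diff_derivable _ _ _ _ _ (z - w) diffw.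
have := deriveE (z - w) diffw; rewrite diff_val => <-.
apply: (@cvgr_to_le _ (0:R)^'+ _ _
  (fun h => h^-1 *: ((fine \o f \o shift w) (h *: (z - w)) - fine (f w)))).
  apply: cvg_trans dq; apply: cvg_app => A.
  have sub : [set h : R | h != 0 -> A h] `<=` [set h | 0 < h -> A h].
    by move=> h /= Ah h0; apply: Ah; rewrite gt_eqF.
  exact: filterS sub.
near=> h.
have h0 : 0 < h by near: h; exact: nbhs_right_gt.
have h1 : h <= 1 by near: h; exact: nbhs_right_le.
have := cf z w h; rewrite (ltW h0) h1 => /(_ isT).
rewrite /= /GRing.scale/= fz -(fineK fw) -!EFinM -EFinD => le1.
have E : h *: (z - w) + w = h *: z + (1 - h) *: w.
  by rewrite scalerBr scalerBl scale1r -addrA [- _ + w]addrC.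
rewrite E ler_pdivrMl//.
move: le1; case fh : (f (h *: z + (1 - h) *: w)) => [b| |] //=.
  rewrite lee_fin; lra.
by have := fNy (h *: z + (1 - h) *: w); rewrite fh.
Unshelve. all: by end_near. Qed.

Lemma proj_n_shift_e (R : realType) n (x : Rinf R) i (ni : (i < n)%N) t :
  proj_n n x - proj_n n (shift_e i t x) = - t *: delta_mx ord0 (Ordinal ni)
  :> 'rV[R]_n.
Proof.
apply/rowP => j; rewrite !mxE/= /shift_e opprD addrA subrr sub0r mulNr.
by rewrite eq_sym.
Qed.

Lemma dotv_delta (R : realType) n (x : 'rV[R]_n) a j :
  dotv x (a *: delta_mx ord0 j) = a * x ord0 j.
Proof.
rewrite /dotv (bigD1 j)//= big1 ?addr0 => [|k kj].
  by rewrite !mxE !eqxx mulr1 mulrC.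
by rewrite !mxE (negbTE kj) andbF !mulr0.
Qed.

Lemma dotvC (R : realType) n (x y : 'rV[R]_n) : dotv x y = dotv y x.
Proof. by apply: eq_bigr => j _; rewrite mulrC. Qed.

Lemma dotvBl (R : realType) n (x y z : 'rV[R]_n) :
  dotv (x - y) z = dotv x z - dotv y z.
Proof.
by rewrite /dotv -sumrB; apply: eq_bigr => j _; rewrite !mxE mulrBl.
Qed.

(** With w = P_n (x + t e_i), add phi_n (P_n x) >= phi_n w - t v_i, which is the
    subgradient inequality at w, to phi_n w + psi_n (P_n y) >= <w, P_n y>, whose
    right-hand side is <P_n x, P_n y> + t y_i. *)
Lemma gap_ge (R : realType) (phi psi : forall n, Rn R n -> \bar R)
    n i (ni : (i < n)%N) (t : R) (x y : Rinf R) (v : 'rV[R]_n) :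
  econvex (phi n) ->
  (forall x y, ((dotv x y)%:E <= phi n x + psi n y)%E) ->
  is_gradient (phi n) (proj_n n (shift_e i t x)) v ->
  ((t * ((y i : R) - v ord0 (Ordinal ni)))%:E <= Fn0 phi psi n (x, y))%E.
Proof.
move=> cphi ge grad.
have phiNy u : phi n u != -oo%E.
  by apply/eqP => h; have := ge u 0; rewrite h addNye leeNy_eq.
have := @subgradient _ _ _ _ _ (proj_n n x) cphi phiNy grad.
rewrite proj_n_shift_e dotv_delta /Fn0/=.
have fw := nbhs_singleton grad.1.
have := ge (proj_n n (shift_e i t x)) (proj_n n y).
have -> : dotv (proj_n n (shift_e i t x)) (proj_n n y) =
    dotv (proj_n n x) (proj_n n y) + t * (y i : R).
  apply/eqP; rewrite addrC -subr_eq -dotvBl -opprB proj_n_shift_e dotvC.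
  by rewrite scaleNr opprK dotv_delta mxE.
rewrite -(fineK fw).
set a := fine _; set p := phi n (proj_n n x).
set q := psi n (proj_n n y); set d := dotv (proj_n n x) _.
set vi := v ord0 _.
case: q => [q| |]; case: p => [p| |] //=; rewrite ?lee_fin ?leey//.
lra.
Qed.

(** * Continuity of shifts in total variation *)

Lemma cvge_lt0 (R : realType) T (F : set_system T) {FF : Filter F}
    (f : T -> \bar R) (d : R) :
  f @ F --> 0%E -> 0 < d -> \forall x \near F, (f x < d%:E)%E.
Proof.
move=> cf d0; apply: (cf [set y | (y < d%:E)%E]).
by apply: open_nbhs_nbhs; split; [exact: open_ereal_lt_ereal|rewrite /= lte_fin].
Qed.

(** Either [a <= e], or [a = a `^ q / a `^ (q - 1)] and the denominator is at least
    [e `^ (q - 1)]. Integrated, this turns a bound on a [q]-th moment into a bound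
    in L^1. *)
Lemma le_add_powR (R : realType) (a e q : R) : 0 <= a -> 0 < e -> 1 <= q ->
  a <= e + (e `^ (q - 1))^-1 * a `^ q.
Proof.
move=> a0 e0 q1; have b0 : 0 < e `^ (q - 1) by exact: powR_gt0.
have [ae|ea] := leP a e.
  by rewrite (le_trans ae)// lerDl mulr_ge0// ?invr_ge0 ?powR_ge0// ltW.
have -> : a `^ q = a `^ (q - 1) * a.
  have ap : 0 < a by exact: lt_trans ea.
  rewrite -[X in _ * X](@powRr1 _ a)// -powRD ?subrK//.
  by rewrite (gt_eqF ap) implybT.
rewrite -[leLHS]add0r lerD ?(ltW e0)// mulrA.
apply: ler_peMl => //; rewrite mulrC ler_pdivlMr// mul1r.
by apply: ge0_ler_powR; rewrite ?subr_ge0 ?nnegrE ?(ltW e0) ?(ltW ea).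
Qed.

Lemma integral_abs_le (R : realType) d (X : measurableType d)
    (mu : probability X R) (g : X -> R) (e q : R) :
  measurable_fun setT g -> 0 < e -> 1 <= q ->
  (\int[mu]_x (`|g x| `^ q)%:E <= (e * e `^ (q - 1))%:E)%E ->
  (\int[mu]_x `|(g x)%:E| <= (e + e)%:E)%E.
Proof.
move=> mg e0 q1 Iq.
set b := (e `^ (q - 1))^-1.
have b0 : 0 <= b by rewrite invr_ge0 powR_ge0.
have mgq : measurable_fun setT (fun x => (`|g x| `^ q)%:E).
  apply/measurable_EFinP; apply: measurableT_comp (measurable_powR _) _.
  exact: measurableT_comp mg.
have mag : measurable_fun setT (fun x => `|(g x)%:E|%E).
  by apply: measurableT_comp => //; exact/measurable_EFinP.
apply: (@le_trans _ _ (\int[mu]_x (e%:E + b%:E * (`|g x| `^ q)%:E))%E).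
  apply: ge0_le_integral => //.
  - by apply: emeasurable_funD => //; exact: measurable_funeM.
  - by move=> x _; rewrite -EFinM -EFinD lee_fin; exact: le_add_powR.
rewrite ge0_integralD//=; last 3 first.
- by move=> x _; rewrite lee_fin ltW.
- by move=> x _; rewrite -EFinM lee_fin mulr_ge0 ?powR_ge0.
- exact: measurable_funeM.
rewrite integral_cst//= probability_setT mule1.
rewrite ge0_integralZl//.
rewrite EFinD leeD2l//.
apply: le_trans (lee_wpmul2l _ Iq) _; first by rewrite lee_fin.
by rewrite -EFinM lee_fin mulrCA /b mulVf ?mulr1// gt_eqF// powR_gt0.
Qed.

(** The shifted measure of [A] exceeds [mu A] by the integral over [A] of the
    density minus one, and Assumption (A) makes the L^1 norm of that function
    small. The bound has to be uniform in [A]: it is applied to a set that is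
    chosen after [t] and depends on it. *)
Lemma shift_continuity (R : realType) (mu nu : probability (Rinf R) R) i
    (e : R) :
  (forall (i : nat) (t : R), distribution mu (@shift_e R i t) `<< mu) ->
  assumption_A mu nu -> 0 < e ->
  exists2 t : R, 0 < t & forall A, measurable A ->
    (distribution mu (@shift_e R i t) A <= mu A + e%:E)%E.
Proof.
move=> qi hA e0.
have [p [q [eps [[_ q1 _ _] [_ cv]]]]] := hA i.
pose a := e / 2; have a0 : 0 < a by rewrite divr_gt0.
have d0 : 0 < a * a `^ (q - 1) by rewrite mulr_gt0// powR_gt0.
have near_t := cvge_lt0 cv d0.
near (0 : R)^'+ => t.
have t0 : 0 < t by near: t; exact: nbhs_right_gt.
have supt : (ereal_sup [set \int[mu]_x (`|exp_beta mu i s x - 1| `^ q)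
    | s in `[0%R, t]%classic] < (a * a `^ (q - 1))%:E)%E.
  by near: t; exact: near_t.
exists t => // A mA.
pose f := exp_beta mu i t.
have dom : charge_of_finite_measure (distribution mu (@shift_e R i t)) `<< mu.
  exact: qi.
have ff x : f x \is a fin_num by exact: Radon_Nikodym_fin_num.
have If : mu.-integrable setT f by exact: Radon_Nikodym_integrable.
have mf : measurable_fun setT f by exact: measurable_int If.
pose g x := fine (f x) - 1.
have fE x : f x = (g x + 1)%:E by rewrite subrK fineK.
have mg : measurable_fun setT g.
  by apply: measurable_funB => //; exact: (@measurableT_comp _ _ _ _ _ _ fine _ f).
have mag : measurable_fun setT (fun x => `|(g x)%:E|%E).
  by apply: measurableT_comp => //; exact/measurable_EFinP.
have Ig : (\int[mu]_x `|(g x)%:E| <= e%:E)%E.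
  rewrite (_ : e = a + a); last by rewrite /a -splitr.
  apply: (@integral_abs_le _ _ _ _ _ _ q) => //.
  apply: le_trans (ltW supt).
  apply: ereal_sup_ubound; exists t; first by rewrite /= in_itv/= (ltW t0) lexx.
  by apply: eq_integral => x _; rewrite -/(f x) fE -EFinB addrK.
have -> : distribution mu (@shift_e R i t) A = (\int[mu]_(x in A) f x)%E.
  exact: (@Radon_Nikodym_integral _ _ _
    (charge_of_finite_measure (distribution mu (@shift_e R i t)))).
(* Only almost every value of the density is known to be nonnegative: taking
   absolute values first avoids discussing its sign. *)
apply: (le_trans (lee_abs _)).
apply: (le_trans (le_abse_integral _ _ _)) => //.
  exact: measurable_funTS.
apply: (@le_trans _ _ (\int[mu]_(x in A) (1 + `|(g x)%:E|))%E).
  apply: ge0_le_integral => //.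
  - by apply: measurableT_comp => //; exact: measurable_funTS.
  - by apply: emeasurable_funD => //; exact: measurable_funTS.
  - by move=> x _; rewrite fE/= lee_fin addrC (le_trans (ler_normD _ _))// normr1.
rewrite ge0_integralD//=; last exact: measurable_funTS.
rewrite integral_cst// mul1e leeD2l// (le_trans _ Ig)//.
exact: ge0_subset_integral.
Unshelve. all: by end_near. Qed.

(** * Functions that factor through a map up to a null set *)

Section approximation.
Context (R : realType) d (Z : measurableType d) (P : probability Z R)
  d' (X : measurableType d') (g : Z -> X).
Hypothesis mg : measurable_fun setT g.

Let measurable_pre A : measurable A -> measurable (g @^-1` A).
Proof. by move=> mA; rewrite -[_ @^-1` _]setTI; exact: mg. Qed.

(** Approximations with summable errors converge: the symmetric difference of an
    upper limit of preimages with [B] lies in the upper limit of the symmetric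
    differences, which is null by Borel-Cantelli. *)
Lemma approximable_preimage (B : set Z) : measurable B ->
  (forall e : R, 0 < e -> exists2 A, measurable A &
     (P (g @^-1` A `+` B) <= e%:E)%E) ->
  exists2 A, measurable A & P.-negligible (g @^-1` A `+` B).
Proof.
move=> mB apx.
have /choice[A AP] : forall n : nat, exists A, measurable A /\
    (P (g @^-1` A `+` B) <= (1 / (2 ^ n.+1)%:R : R)%:E)%E.
  move=> n; have [|A mA PA] := apx (1 / (2 ^ n.+1)%:R); last by exists A.
  by rewrite divr_gt0// ltr0n expn_gt0.
have mS n : measurable (g @^-1` A n `+` B).
  have [mA _] := AP n.
  by rewrite setY_def; apply: measurableU; apply: measurableD => //;
    exact: measurable_pre.
exists (lim_sup_set A).
  apply: bigcapT_measurable => n; apply: bigcup_measurable => k _.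
  by have [] := AP k.
exists (lim_sup_set (fun n => g @^-1` A n `+` B)); split.
- apply: bigcapT_measurable => n; exact: bigcup_measurable.
- apply: lim_sup_set_cvg0 => //.
  apply: (@le_lt_trans _ _ (\sum_(n <oo) (1 / (2 ^ n.+1)%:R : R)%:E)%E).
    by apply: lee_nneseries => // n _; have [] := AP n.
  by apply: le_lt_trans (epsilon_trick0 _ ler01) _; rewrite ltry.
- move=> z; rewrite setY_def => -[[Az nBz]|[Bz nAz]] n _.
    by have [k nk Ak] := Az n I; exists k => //; rewrite setY_def; left.
  move/existsNP : nAz => [m /not_implyP[_ nAm]].
  exists (maxn m n); first by rewrite /= leq_maxr.
  rewrite setY_def; right; split => // Ak; apply: nAm; exists (maxn m n) => //.
  by rewrite /= leq_maxl.
Qed.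

(** When [A c] represents the event [f > c], the value [f z] is recovered from [g z]
    as the supremum of the rationals [c] with [g z] in [A c]. *)
Lemma factor_through (f : Z -> R) :
  (forall c : rat, exists2 A, measurable A &
     P.-negligible (g @^-1` A `+` [set z | ratr c < f z])) ->
  exists2 h : X -> R, measurable_fun setT h & {ae P, forall z, h (g z) = f z}.
Proof.
move=> /(_ _)/cid2-/all_sig2[A mA nA].
pose U x := ereal_sup [set ((ratr c)%:E : \bar R) | c in [set c | A c x]].
have UP (a : R) x : (a%:E < U x)%E <-> exists2 c, A c x & a < ratr c.
  split.
    by move=> /ereal_sup_gt[_ [c Ac <-]]; rewrite lte_fin; exists c.
  move=> [c Ac ac]; apply: (@lt_le_trans _ _ (ratr c)%:E); rewrite ?lte_fin//.
  by apply: ereal_sup_ubound; exists c.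
exists (fine \o U).
  apply: measurableT_comp => //.
  apply: (measurability _ (ErealGenOInfty.measurableE R)) => _ [_ [a ->] <-].
  rewrite setTI.
  have -> : U @^-1` `]a%:E, +oo[%classic = \bigcup_(c in [set c : rat | a < ratr c]) A c.
    apply/seteqP; split => x /=.
      by rewrite in_itv/= andbT => /UP[c ? ?]; exists c.
    by move=> [c ? ?]; rewrite in_itv/= andbT; apply/UP; exists c.
  rewrite bigcup_mkcond; apply: countable_bigcupT_measurable => // c.
  by case: ifP.
(* Countable intersections of almost sure events are indexed by naturals, so the
   rationals are enumerated. *)
have : {ae P, forall z n, if unpickle n is Some c
    then A c (g z) <-> ratr c < f z else True}.
  apply: ae_foralln => n; case: (unpickle n) => [c|]; last exact: aeW.
  apply: negligibleS (nA c) => z; rewrite setY_def /= => nAc.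
  have [Ac|Ac] := pselect (A c (g z)); [left|right]; split => //=.
    by move=> cf; apply: nAc.
  by apply: contrapT => cf; apply: nAc.
apply: filterS => z AE0.
have {AE0} AE c : A c (g z) <-> ratr c < f z.
  by have := AE0 (pickle c); rewrite pickleK.
suff Uf : U (g z) = (f z)%:E by rewrite /= Uf.
have [c0] := @rat_in_itvoo R (f z - 1) (f z) ltac:(by rewrite ltrBlDr ltrDl).
rewrite in_itv/= => /andP[_ c0f].
have le : (U (g z) <= (f z)%:E)%E.
  by apply: ge_ereal_sup => _ [c /AE cf <-]; rewrite lee_fin ltW.
have ge : ((ratr c0)%:E <= U (g z))%E.
  by apply: ereal_sup_ubound; exists c0 => //; exact/AE.
apply/eqP; rewrite eq_le le/= leNgt; apply/negP.
move: le ge (UP ^~ (g z)); case: (U (g z)) => [u| |]// _ _ UP'.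
rewrite lte_fin => /rat_in_itvoo[c]; rewrite in_itv/= => /andP[uc cf].
have /UP' : exists2 c, A c (g z) & u < ratr c by exists c => //; exact/AE.
by rewrite ltxx.
Qed.

End approximation.

(** * Approximating the level sets of a coordinate *)

Lemma small_slab (R : realType) d (Z : measurableType d) (P : probability Z R)
    (f : Z -> R) (c e : R) : measurable_fun setT f -> 0 < e ->
  exists2 h : R, 0 < h & (P [set z | c < f z <= c + h]%R < e%:E)%E.
Proof.
move=> mf e0.
pose S k := [set z | (c < f z <= c + k.+1%:R^-1)%R].
have SE k : S k = f @^-1` `]c, c + k.+1%:R^-1]%classic.
  by apply/seteqP; split => z /=; rewrite in_itv.
have mS k : measurable (S k) by rewrite SE -[_ @^-1` _]setTI; exact: mf.
have S0 : \bigcap_k S k = set0.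
  rewrite -subset0 => z Sz; have /andP[cf _] := Sz 0%N I.
  have fc0 : 0 < f z - c by rewrite subr_gt0.
  have [k] := ltr_add_invr fc0; rewrite add0r => kf.
  by have /andP[_] := Sz k I; rewrite -lerBlDl leNgt kf.
have cS : P (S k) @[k --> \oo] --> 0%E.
  rewrite -(measure0 P) -S0; apply: nonincreasing_cvg_mu => //.
  - by rewrite (le_lt_trans (probability_le1 _ _))// ltry.
  - by rewrite S0.
  - move=> k l kl; apply/subsetPset => z /andP[cf fl]; apply/andP; split => //.
    by rewrite (le_trans fl)// lerD2l lef_pV2 ?posrE ?ltr0n// ler_nat.
have [k] := filter_ex (cvge_lt0 cS e0).
by exists k.+1%:R^-1 => //; rewrite invr_gt0 ltr0n.
Qed.

Lemma measurable_Fn0 (R : realType) (phi psi : forall n, Rn R n -> \bar R) n :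
  measurable_fun setT (phi n) -> measurable_fun setT (psi n) ->
  measurable_fun setT (Fn0 phi psi n).
Proof.
move=> mphi mpsi.
have m1 : measurable_fun setT (fun z : Rinf R * Rinf R => proj_n n z.1).
  exact: measurableT_comp (@measurable_proj_n R n) measurable_fst.
have m2 : measurable_fun setT (fun z : Rinf R * Rinf R => proj_n n z.2).
  exact: measurableT_comp (@measurable_proj_n R n) measurable_snd.
apply: emeasurable_funB.
  by apply: emeasurable_funD; [exact: measurableT_comp m1|exact: measurableT_comp m2].
apply/measurable_EFinP; apply: measurable_sum => j; apply: measurable_funM.
  exact: measurableT_comp (@measurable_Rn_coord R n j) m1.
exact: measurableT_comp (@measurable_Rn_coord R n j) m2.
Qed.

(** Quasi-invariance carries properties that hold mu_n-almost everywhere, such as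
    differentiability of phi_n, to the shifted points P_n (x + t e_i). *)
Lemma ae_shift_proj (R : realType) (mu : probability (Rinf R) R)
    (pi : probability (Rinf R * Rinf R)%type R) n i t (Q : Rn R n -> Prop) :
  distribution mu (@shift_e R i t) `<< mu ->
  (forall A, measurable A -> pi (fst @^-1` A) = mu A) ->
  {ae distribution mu (@proj_n R n), forall u, Q u} ->
  {ae pi, forall z, Q (proj_n n (shift_e i t z.1))}.
Proof.
move=> qi fstpi [N [mN N0 QN]].
have mpN : measurable (@proj_n R n @^-1` N).
  by rewrite -[_ @^-1` _]setTI; exact: measurable_proj_n.
have mB : measurable (@shift_e R i t @^-1` (@proj_n R n @^-1` N)).
  by rewrite -[_ @^-1` _]setTI; exact: measurable_shift_e.
exists (fst @^-1` (@shift_e R i t @^-1` (@proj_n R n @^-1` N))); split.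
- by rewrite -[_ @^-1` _]setTI; exact: measurable_fst.
- rewrite fstpi//.
  exact: (qi _ ((measure0_null_setP mu mpN).2 N0) _ mpN (@subset_refl _ _)).
- by move=> z /= nQ; exact: QN.
Qed.

Unset Implicit Arguments.

Section ray.
Variables (R : realType) (mu nu : probability (Rinf R) R).
Variable quasi_invariant : forall (i : nat) (t : R),
  distribution mu (@shift_e R i t) `<< mu.
Hypothesis hA : assumption_A mu nu.
Variable pi_ : forall n : nat, probability (Rn R n * Rn R n)%type R.
Variables phi psi : forall n : nat, Rn R n -> \bar R.
Hypothesis potentials : forall n : nat, (0 < n)%N ->
  dual_solution (distribution mu (@proj_n R n))
    (distribution nu (@proj_n R n)) (pi_ n) (phi n) (psi n).
Variable pi : probability (Rinf R * Rinf R)%type R.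
Variables (F : set_system nat) (FF : ProperFilter F).
Hypothesis F_oo : F --> \oo.
Hypothesis F_to_0 : cvg_in_measure F pi (Fn0 phi psi).
Hypothesis fstpi : forall A, measurable A -> pi (fst @^-1` A) = mu A.
Hypothesis sndpi : forall A, measurable A -> pi (snd @^-1` A) = nu A.

(** The set is A = {x | T_n (P_n (x + t e_i))_i > c}. Three small errors are fixed
    in turn: [t] bounds the effect of the shift, then [h] the mass of the slab
    c < y_i <= c + h, and finally [n] the probability that the gap is at least
    t h. Off the slab and this last event, y_i > c forces x in A. *)
Lemma ray_approximation i (c e : R) : 0 < e ->
  exists2 A, measurable A &
    (pi (fst @^-1` A `+` [set z | c < (z.2 i : R)]%R) <= e%:E)%E.
Proof.
move=> e0.
(* The symmetric difference costs 2d on the side {y_i > c} \ A, and 3d on the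
   other side, where the comparison of mu A with nu {y_i > c} adds one more d. *)
pose d := e / 5; have d0 : 0 < d by rewrite divr_gt0.
have [t t0 tP] := shift_continuity i quasi_invariant hA d0.
have mi : measurable_fun setT (fun z : Rinf R * Rinf R => z.2 i : R).
  exact: measurableT_comp (@measurable_coord R i) measurable_snd.
have [h h0 hP] := small_slab pi c mi d0.
have th0 : 0 < t * h by rewrite mulr_gt0.
have nearn : \forall n \near F, (i < n)%N by apply: F_oo; exact: nbhs_infty_gt.
have [n [gapn ni]] :=
  filter_ex (filterI (cvge_lt0 (F_to_0 _ th0) d0) nearn).
have n0 : (0 < n)%N by exact: leq_ltn_trans ni.
have dn := potentials _ n0.
have [T [mT pushT _] gradT] := dual_gradient_phi dn.
pose Y (u : Rn R n) : R := (u : 'rV[R]_n) ord0 (Ordinal ni).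
have mY : measurable_fun setT Y by exact: measurable_Rn_coord.
have mray : measurable [set u : Rn R n | c < Y u].
  rewrite (_ : mkset _ = Y @^-1` `]c, +oo[%classic).
    by rewrite -[_ @^-1` _]setTI; exact: mY.
  by apply/seteqP; split => u /=; rewrite in_itv/= andbT.
have mTray : measurable (T @^-1` [set u | c < Y u]).
  by rewrite -[_ @^-1` _]setTI; exact: mT.
have mpre B : measurable B -> measurable (@proj_n R n @^-1` B).
  by move=> mB; rewrite -[_ @^-1` _]setTI; exact: measurable_proj_n.
pose A := @shift_e R i t @^-1` (@proj_n R n @^-1` (T @^-1` [set u | c < Y u])).
have mA : measurable A.
  by rewrite /A -[_ @^-1` _]setTI; apply: measurable_shift_e => //; exact: mpre.
have mfA : measurable (fst @^-1` A : set (Rinf R * Rinf R)).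
  by rewrite -[_ @^-1` _]setTI; exact: measurable_fst.
pose B := [set z : Rinf R * Rinf R | c < (z.2 i : R)].
have BE : B = snd @^-1` (@proj_n R n @^-1` [set u | c < Y u]).
  by apply/seteqP; split => z; rewrite /B/= /Y mxE.
have mB : measurable B.
  by rewrite BE -[_ @^-1` _]setTI; apply: measurable_snd => //; exact: mpre.
have muA : (mu A <= pi B + d%:E)%E.
  have pushE : mu (@proj_n R n @^-1` (T @^-1` [set u | c < Y u])) =
      nu (@proj_n R n @^-1` [set u | c < Y u]) := pushT _ mray.
  rewrite BE sndpi; last exact: mpre.
  by rewrite -pushE; exact: tP (mpre _ mTray).
pose S := [set z : Rinf R * Rinf R | c < (z.2 i : R) <= c + h].
have mS : measurable S.
  rewrite (_ : S = (fun z : Rinf R * Rinf R => z.2 i : R) @^-1` `]c, c + h]%classic).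
    by rewrite -[_ @^-1` _]setTI; exact: mi.
  by apply/seteqP; split => z /=; rewrite in_itv.
pose G := [set z | ((t * h)%:E <= `|Fn0 phi psi n z|)%E].
have mG : measurable G.
  have mF : measurable_fun setT (Fn0 phi psi n).
    apply: measurable_Fn0.
      exact: measurable_int (dual_integrable_phi dn).
    exact: measurable_int (dual_integrable_psi dn).
  rewrite -[G]setTI; apply: emeasurable_fun_c_infty => //.
  exact: measurableT_comp mF.
have [N [mN N0 subN]] := ae_shift_proj (quasi_invariant i t) fstpi gradT.
have BA : (pi (B `\` fst @^-1` A) <= d%:E + d%:E)%E.
  apply: (@le_trans _ _ (pi (S `|` G `|` N))).
    rewrite le_measure ?inE//; [exact: measurableD| |].
      by do 2?apply: measurableU.
    move=> z [Bz Az]; have [zN|zN] := pselect (N z); [by right|left].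
    have [hz|hz] := leP (z.2 i : R) (c + h); [left|right].
      by apply/andP; split.
    have grad : is_gradient (phi n) (proj_n n (shift_e i t z.1))
        (T (proj_n n (shift_e i t z.1))).
      by apply: contrapT => ng; apply: zN; exact: subN.
    have := @gap_ge R phi psi n i ni t z.1 z.2 _ (dual_convex_phi dn)
      (dual_ge dn) grad.
    rewrite -surjective_pairing => gap; apply: le_trans (lee_abs _).
    apply: le_trans gap; rewrite lee_fin ler_pM2l//.
    have /negP : ~ c < Y (T (proj_n n (shift_e i t z.1))) by exact: Az.
    by rewrite -leNgt /Y; lra.
  rewrite (le_trans (measureU2 _ _ _))//; first exact: measurableU.
  rewrite [X in (_ + X)%E]N0 adde0 (le_trans (measureU2 _ _ _))//.
  by apply: leeD; exact: ltW.
exists A => //; rewrite setY_def (le_trans (measureU2 _ _ _))//;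
  [exact: measurableD..|].
have : (pi (fst @^-1` A `\` B) <= pi (B `\` fst @^-1` A) + d%:E)%E.
  have fin C : measurable C -> pi C \is a fin_num by move=> ?; exact: fin_num_measure.
  have e1 : (pi (fst @^-1` A) =
      pi (fst @^-1` A `\` B) + pi (fst @^-1` A `&` B))%E := measureDI pi mfA mB.
  have e2 : (pi B = pi (B `\` fst @^-1` A) + pi (fst @^-1` A `&` B))%E.
    by rewrite setIC; exact: measureDI.
  move: muA; rewrite -fstpi// e1 e2.
  have /fineK <- := fin _ (measurableD mfA mB).
  have /fineK <- := fin _ (measurableD mB mfA).
  have /fineK <- := fin _ (measurableI _ _ mfA mB).
  by rewrite -!EFinD !lee_fin; lra.
move=> AB; apply: (@le_trans _ _ ((d%:E + d%:E + d%:E) + (d%:E + d%:E))%E).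
  by apply: leeD => //; apply: le_trans AB _; rewrite leeD2r.
by rewrite -!EFinD lee_fin /d; lra.
Qed.

End ray.

(** * The transport map *)

Theorem theorem3p4 (R : realType)
    (mu nu : probability (Rinf R) R)
    (quasi_invariant : forall (i : nat) (t : R),
      distribution mu (@shift_e R i t) `<< mu)
    (hA : assumption_A mu nu)
    (pi_ : forall n : nat, probability (Rn R n * Rn R n)%type R)
    (phi psi : forall n : nat, Rn R n -> \bar R)
    (pi_optimal : forall n : nat, (0 < n)%N ->
      optimal_plan (distribution mu (@proj_n R n))
        (distribution nu (@proj_n R n)) (pi_ n))
    (potentials : forall n : nat, (0 < n)%N ->
      dual_solution (distribution mu (@proj_n R n))
        (distribution nu (@proj_n R n)) (pi_ n) (phi n) (psi n))
    (pi_tight : tight (fun n => distribution (pi_ n) (@incl2_n R n)))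
    (N' : set nat) (N'_infinite : infinite_set N')
    (pi : probability (Rinf R * Rinf R)%type R)
    (pi_limit : weak_limit (within N' \oo)
      (fun n => distribution (pi_ n) (@incl2_n R n)) pi)
    (F_to_0 : cvg_in_measure (within N' \oo) pi (Fn0 phi psi)) :
  exists2 T : Rinf R -> Rinf R,
    measurable_fun [set: Rinf R] T & {ae pi, forall z, T z.1 = z.2}.
Proof.
have FF := within_infinite_proper N'_infinite.
have F_oo : within N' \oo --> \oo by exact: cvg_within.
have fstpi : forall A, measurable A -> pi (fst @^-1` A) = mu A.
  apply: (@limit_marginal R _ FF F_oo _ _ pi_limit mu fst (fun n => fst)) => //.
  - by move=> z; exact: cvg_fst.
  - move=> n n0 A mA; have [+ _] := (pi_optimal _ n0).1 _ mA.
    by rewrite -setXT.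
have sndpi : forall A, measurable A -> pi (snd @^-1` A) = nu A.
  apply: (@limit_marginal R _ FF F_oo _ _ pi_limit nu snd (fun n => snd)) => //.
  - by move=> z; exact: cvg_snd.
  - move=> n n0 A mA; have [_ +] := (pi_optimal _ n0).1 _ mA.
    by rewrite -setTX.
have /choice[T TP] : forall i, exists h : Rinf R -> R,
    measurable_fun setT h /\ {ae pi, forall z, h z.1 = z.2 i}.
  move=> i.
  have mi : measurable_fun setT (fun z : Rinf R * Rinf R => z.2 i : R).
    exact: measurableT_comp (@measurable_coord R i) measurable_snd.
  have [|h mh hE] := @factor_through R _ _ pi _ _ fst (fun z => z.2 i).
  - move=> c; apply: approximable_preimage; [exact: measurable_fst| |].
      rewrite (_ : mkset _ = (fun z : Rinf R * Rinf R => z.2 i : R) @^-1`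
        `]ratr c, +oo[%classic).
        by rewrite -[_ @^-1` _]setTI; exact: mi.
      by apply/seteqP; split => z /=; rewrite in_itv/= andbT.
    move=> e e0.
    exact: (@ray_approximation R mu nu quasi_invariant hA pi_ phi psi potentials
      pi _ FF F_oo F_to_0 fstpi sndpi).
  - by exists h.
exists (fun x i => T i x).
  by apply: measurable_Rinf => i; have [] := TP i.
have : {ae pi, forall z i, T i z.1 = z.2 i}.
  by apply: ae_foralln => i; have [] := TP i.
by apply: negligibleS => z; apply: contra_not => /funext.
Qed.
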